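(* Let $\varepsilon>0$, let $r>1$, and let $(a_n)_{n\in\mathbb{N}}$ be an increasing sequence of positive integers which is lacunary with growth factor $r$. Then for Lebesgue-almost all $\alpha\in[0,1]$ there exists $N_0(\alpha)\in\mathbb{N}$ such that $$G(\{\alpha a_n\}_{n\le N})\le\frac{(\log N)^{2+\varepsilon}}{N}$$ for all $N\in\mathbb{N}$ with $N\ge N_0(\alpha)$.
   Context: A sequence $(a_n)_{n\in\mathbb{N}}$ is lacunary with growth factor $r>1$ if $a_{n+1}\ge r a_n$ for every $n\in\mathbb{N}$. Maximal gap: for a finite family of real numbers $z_1,\dots,z_m$ ($m\ge1$), reduce each $z_i$ modulo $1$ to a representative in $[0,1)$ and sort these representatives as $0\le y_1\le y_2\le\dots\le y_m<1$; put $y_{m+1}:=1+y_1$. Then $G(\{z_i\}_{i\le m}):=\max_{2\le k\le m+1}(y_k-y_{k-1})$ is the largest gap between neighbouring points on the unit torus. Thus $G(\{\alpha a_n\}_{n\le N})$ is the maximal gap of the points $\alpha a_1,\dots,\alpha a_N$ modulo $1$. *)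

(* Defs.v *)
(* Sequences indexed by N = {1, 2, ...} are represented by
   functions on nat whose value at 0 is ignored. *)
From mathcomp Require Import all_boot all_order all_algebra.
From mathcomp Require Import all_classical all_reals all_analysis.

Set Implicit Arguments.
Unset Strict Implicit.
Unset Printing Implicit Defensive.

Import Order.TTheory GRing.Theory Num.Theory.

Local Open Scope ring_scope.

Definition lacunary (R : realType) (r : R) (a : nat -> nat) : Prop :=
  1 < r /\ forall n : nat, (1 <= n)%N -> r * (a n)%:R <= (a n.+1)%:R.

Definition frac_part (R : realType) (x : R) : R := x - (Num.floor x)%:~R.

(* The list y_1 <= ... <= y_m, y_{m+1} = 1 + y_1, stored from index 0. *)
Definition torus_points (R : realType) (z : seq R) : seq R :=
  let y := sort <=%O [seq frac_part x | x <- z] in rcons y (1 + head 0 y).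

(* All the gaps are nonnegative, so the default value 0 of the maximum only
   matters for the empty family. *)
Definition max_gap (R : realType) (z : seq R) : R :=
  let y := torus_points z in
  \big[Num.max/0]_(0 <= k < size z) (y`_k.+1 - y`_k).

(* Main.v *)
(* Among the first N points keep only every L-th one, with L of order log N
   chosen so that the growth factor Q = r ^ L of the thinned sequence exceeds
   4 K, where the torus is cut into K cells of length 1 / K and K is of order
   N / (log N) ^ 2.  The thinned sequence behaves like an independent one:
   between two consecutive returns to the left end of a cell, alpha b spends
   one interval of length (1 - 1 / K) / b outside it, and that interval is so
   long compared with the period of the next dilation that each step
   multiplies the measure of the missing set by at most 1 - 1 / (2 K).
   A union bound over the K cells gives measure O(N ^ -2) for the set of alpha
   leaving some cell empty, Borel-Cantelli applies, and when every cell is hit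
   all gaps are at most 2 / K. *)
Require Import Defs.
From mathcomp Require Import all_boot all_order all_algebra.
From mathcomp Require Import all_classical all_reals all_analysis.
From mathcomp Require Import measurable_realfun.
From mathcomp Require Import ring lra.

Import Order.TTheory GRing.Theory Num.Theory.

Local Open Scope ring_scope.

(** * Fractional parts, and gaps when every cell is hit *)

Lemma frac_part_ge0 (R : realType) (x : R) : 0 <= frac_part x.
Proof. by rewrite subr_ge0 floor_le. Qed.

Lemma frac_part_lt1 (R : realType) (x : R) : frac_part x < 1.
Proof. by have := floorD1_gt x; rewrite /frac_part intrD; lra. Qed.

(** No carry occurs: [u] plus the fractional part of [x - u] stays below [u + s <= 1], so [x] and
    [x - u] have the same floor. *)
Lemma frac_part_shift (R : realType) (x u s : R) :
  0 <= u -> u + s <= 1 -> frac_part (x - u) < s -> u <= frac_part x < u + s.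
Proof.
rewrite /frac_part => u0 us; have := floor_le (x - u).
set p := Num.floor (x - u) => px xp.
have -> : Num.floor x = p by apply: floor_def; rewrite intrD; apply/andP; lra.
by apply/andP; lra.
Qed.

Lemma max_gap_le (R : realType) (K : nat) (z : seq R) : (0 < K)%N ->
  (forall j, (j < K)%N -> exists2 x, x \in z & frac_part (x - j%:R / K%:R) < K%:R^-1) ->
  max_gap z <= 2 / K%:R.
Proof.
move=> K0 hit; set k : R := K%:R^-1.
have k0 : 0 < k by rewrite invr_gt0 ltr0n.
have kK : K%:R * k = 1 by rewrite divff// pnatr_eq0 -lt0n.
rewrite /max_gap /torus_points; set y := sort _ _.
have sz : size y = size z by rewrite size_sort size_map.
have ysort : sorted <=%R y by apply: sort_sorted; exact: le_total.
have cell j : (j < K)%N -> exists2 i, (i < size y)%N & j%:R * k <= y`_i < j%:R * k + k.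
  move=> jK; have [x xz xj] := hit j jK.
  have : frac_part x \in y by rewrite mem_sort map_f.
  move=> /(nthP 0)[i iy yi]; exists i => //; rewrite yi.
  apply: frac_part_shift => //; first by rewrite mulr_ge0// ltW.
  have : j.+1%:R * k <= K%:R * k by rewrite ler_pM2r// ler_nat.
  by rewrite kK -natr1; lra.
have yle i j : (i <= j)%N -> (j < size y)%N -> y`_i <= y`_j.
  move=> ij jy; apply: (sorted_leq_nth le_trans le_refl _ ysort) => //.
  by rewrite inE (leq_ltn_trans ij).
have y01 i : (i < size y)%N -> 0 <= y`_i < 1.
  move=> iy; have := mem_nth 0 iy; rewrite mem_sort => /mapP[x _ ->].
  by rewrite frac_part_ge0 frac_part_lt1.
rewrite big_seq; elim/big_ind: _ => [|x x' hx hx'|i].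
- by rewrite mulr_ge0// ltW.
- by rewrite ge_max hx.
rewrite mem_index_iota/= -sz => iy; rewrite !nth_rcons iy.
have [iy'|] := ltnP i.+1 (size y).
  have /andP[yi0 _] := y01 _ iy; have /andP[_ yi1] := y01 _ iy'.
  (* A gap longer than [2 * k] contains the whole cell [j.+1], where [j] is the cell of its left
     end. The point hitting that cell would lie strictly between two neighbours. *)
  rewrite leNgt; apply/negP => gap.
  have yi : y`_i = (y`_i * K%:R) * k by rewrite -mulrA kK mulr1.
  have ty : 0 <= y`_i * K%:R by rewrite mulr_ge0.
  have /andP[] := truncn_itv ty; set j := Num.Def.trunc _ => j1 j2.
  have hj1 : j%:R * k <= y`_i by rewrite yi ler_wpM2r// ltW.
  have hj2 : y`_i < j.+1%:R * k by rewrite yi ltr_pM2r.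
  have jk : (j.+1 < K)%N.
    rewrite -(ltr_nat R) -(ltr_pM2r k0) kK -natr1; lra.
  have [l ly /andP[yl1 yl2]] := cell _ jk.
  have [li|il] := leqP l i.
    by have := yle _ _ li iy; lra.
  by have := yle _ _ il ly; move: yl2; rewrite -natr1; lra.
(* The wrap-around gap: the hit in cell 0 puts the smallest point below [k], and the hit in the last
   cell puts the largest at or above [1 - k]. *)
rewrite leq_eqVlt ltnNge iy orbF => /eqP eyi; rewrite eyi eqxx.
have [l ly /andP[_ yl2]] := cell _ K0.
have K1 : (K.-1 < K)%N by rewrite prednK.
have [m my /andP[ym1 _]] := cell _ K1.
have y0l := yle _ _ (leq0n l) ly.
have ymi : y`_m <= y`_i by apply: yle => //; rewrite -ltnS -eyi.
have e : K.-1%:R * k = 1 - k.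
  by have := kK; rewrite -{1}(prednK K0) -natr1; lra.
by rewrite -nth0; rewrite e in ym1; rewrite mul0r add0r in yl2; lra.
Qed.

(** * Measure of the set of dilations that miss one arc *)

Section avoid.
Context {R : realType}.
Local Notation mu := (@lebesgue_measure R).

(** For [0 < s <= 1] the inequality keeps [x * b] off the arc [[u, u + s)] modulo 1; subtracting [u]
    first avoids a case split at the wrap-around. *)
Definition avoid (u s : R) (bs : seq R) : set R :=
  [set x | all (fun b => s <= frac_part (x * b - u)) bs].

Lemma measurable_frac_part : measurable_fun setT (@frac_part R).
Proof.
apply: measurable_funB => //; apply: nondecreasing_measurable => // x y xy.
by rewrite ler_int le_floor.
Qed.

Lemma measurable_avoid u s bs : measurable (avoid u s bs).
Proof.
elim: bs => [|b bs ih].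
  by rewrite [X in measurable X](_ : _ = setT)//; apply/seteqP; split.
rewrite [X in measurable X](_ : _ = [set x | s <= frac_part (x * b - u)] `&` avoid u s bs)%classic.
  apply: measurableI => //.
  rewrite -[X in measurable X]setTI.
  rewrite [X in measurable (_ `&` X)](_ : _ = (fun x => frac_part (x * b - u)) @^-1` `[s, +oo[)%classic; last first.
    by apply/seteqP; split=> x /=; rewrite in_itv/= andbT.
  have mf : measurable_fun setT (fun x : R => frac_part (x * b - u)).
    apply: (measurableT_comp measurable_frac_part).
    by apply: measurable_funB => //; exact: measurable_funM.
  exact: mf.
by apply/seteqP; split=> x /=; rewrite /avoid/= => /andP.
Qed.

(* The term 2 / (Q * b0) absorbs the incomplete periods at both ends of the
   interval; it is what makes the estimate stable under induction. *)
Lemma avoid_measure (u s Q : R) (bs : seq R) (b0 x l : R) :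
  0 < s <= 1 -> 4 <= s * Q -> 0 < b0 -> 0 <= l ->
  path (fun p q => Q * p <= q) b0 bs ->
  (mu (`[x, (x + l)%R] `&` avoid u s bs)%classic
     <= ((1 - s / 2) ^+ size bs * (l + 2 / (Q * b0)))%R%:E)%E.
Proof.
move=> /andP[s0 s1] sQ; have Q0 : 0 < Q by have := mulr_gt0 s0 s0; nra.
set c : R := 1 - s / 2; have c0 : 0 < c by rewrite /c; lra.
elim: bs b0 x l => [|b bs ih] b0 x l b00 l0 /=.
  move=> _; rewrite expr0 mul1r.
  apply: (@le_trans _ _ (mu `[x, x + l]%classic)).
    by apply: le_measure; rewrite ?inE//; apply: measurableI => //; exact: measurable_avoid.
  rewrite lebesgue_measure_itv/= lte_fin; case: ifPn => _.
    by rewrite -EFinB lee_fin addrAC subrr add0r lerDl divr_ge0// mulr_ge0// ltW.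
  by rewrite lee_fin addr_ge0// divr_ge0// mulr_ge0// ltW.
move=> /andP[b0b pbs].
have b_gt0 : 0 < b by rewrite (lt_le_trans _ b0b)// mulr_gt0.
(* I i is the part of the i-th period of t |-> t * b - u, of length 1 / b,
   whose fractional part is at least s. *)
pose m0 := Num.floor (x * b - u).
(* An interval of length [l] meets at most this many periods, counting the incomplete ones at both
   ends. *)
pose n := (Num.truncn (l * b)).+2.
pose lo (i : nat) := ((m0 + i)%:~R + u + s) / b.
pose I (i : nat) := (`[lo i, lo i + (1 - s) / b] `&` avoid u s bs)%classic.
have mI i : measurable (I i) by apply: measurableI => //; exact: measurable_avoid.
have cover : (`[x, x + l] `&` avoid u s (b :: bs) `<=` \big[setU/set0]_(i < n) I i)%classic.
  move=> t [/=]; rewrite in_itv/= => /andP[xt tx] /andP[tb tbs].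
  pose m := Num.floor (t * b - u).
  have m0m : m0 <= m by apply: le_floor; rewrite lerB// ler_pM2r.
  have [i mi] : exists i : nat, m = m0 + i.
    by exists `|m - m0|%N; rewrite gez0_abs ?subr_ge0// subrKC.
  have ilt : (i < n)%N.
    rewrite -(ltr_nat R).
    have := floor_le (t * b - u); rewrite -/m mi intrD.
    have := floorD1_gt (x * b - u); rewrite -/m0 intrD.
    have lb : 0 <= l * b by rewrite mulr_ge0// ltW.
    have /andP[_] := truncn_itv lb.
    have : t * b <= x * b + l * b by rewrite -mulrDl ler_pM2r.
    by rewrite /n -natr1; lra.
  rewrite -bigcup_mkord; exists i => //; split => //=; rewrite in_itv/=.
  rewrite /lo -mi -mulrDl ler_pdivrMr// ler_pdivlMr//.
  move: tb; rewrite /frac_part -/m.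
  by have := floorD1_gt (t * b - u); rewrite -/m intrD => *; apply/andP; lra.
(* Induction on an interval of length [(1 - s) / b] gives the factor [(1 - s + 2 / Q) / b]. Since
   [4 <= s * Q], the error [2 / Q] costs at most half of the gain [s], which leaves [c / b]. *)
have bound i : (mu (I i) <= (c ^+ size bs * (c / b))%R%:E)%E.
  apply: (le_trans (ih b _ _ b_gt0 _ pbs)).
    by rewrite divr_ge0 ?subr_ge0// ltW.
  rewrite lee_fin ler_pM2l ?exprn_gt0//.
  rewrite invfM mulrA -mulrDl ler_pM2r ?invr_gt0//.
  have : 2 / Q <= s / 2 by rewrite ler_pdivrMr//; lra.
  by rewrite /c; lra.
have mA : measurable (`[x, x + l] `&` avoid u s (b :: bs))%classic.
  by apply: measurableI => //; exact: measurable_avoid.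
apply: (le_trans (@content_subadditive _ _ _ mu _ I n (fun k _ => mI k) mA cover)).
apply: (@le_trans _ _ (\sum_(i < n) (c ^+ size bs * (c / b))%:E)%E).
  by apply: lee_sum => i _; exact: bound.
rewrite sumEFin lee_fin sumr_const card_ord.
have lb : 0 <= l * b by rewrite mulr_ge0// ltW.
have n_le : n%:R <= l * b + 2.
  by have /andP[+ _] := truncn_itv lb; rewrite /n -2!natr1; lra.
apply: (@le_trans _ _ ((l * b + 2) * (c ^+ size bs * (c / b)))).
  by rewrite -[leLHS]mulr_natl ler_wpM2r// mulr_ge0// ?exprn_ge0 ?divr_ge0// ltW.
(* The two extra periods become [2 / b], which [Q * b0 <= b] turns back into the error term of the
   claim. *)
have -> : (l * b + 2) * (c ^+ size bs * (c / b)) = c ^+ (size bs).+1 * (l + 2 / b).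
  by rewrite exprS; field; rewrite gt_eqF.
apply: ler_wpM2l; first by rewrite exprn_ge0// ltW.
by rewrite lerD2l ler_pM2l// lef_pV2 ?posrE// mulr_gt0.
Qed.

(** * Borel-Cantelli for measures of order [1 / n ^ 2] *)

Lemma borel_cantelli_inv_sqr (F : nat -> set R) (C : R) :
  (forall n, measurable (F n)) ->
  (forall n, (mu (F n) <= (C / n.+1%:R ^+ 2)%R%:E)%E) ->
  mu (lim_sup_set F) = 0%E.
Proof.
move=> mF hF; apply: lim_sup_set_cvg0 => //.
have C0 : 0 <= C.
  have := le_trans (measure_ge0 mu (F 0%N)) (hF 0%N).
  by rewrite lee_fin expr1n divr1.
apply: (@le_lt_trans _ _ (C * 2)%:E); last exact: ltry.
apply: lime_le; first exact: is_cvg_nneseries.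
apply: nearW => n; rewrite big_mkord.
apply: (@le_trans _ _ (\sum_(i < n) (C / i.+1%:R ^+ 2)%:E)%E).
  by apply: lee_sum => i _; exact: hF.
rewrite sumEFin lee_fin -mulr_sumr ler_wpM2l//.
(* Subtracting [2 / n.+1] strengthens the bound 2 so that it passes through induction; it is an
   equality for the empty sum. *)
suff : \sum_(i < n) (i.+1%:R ^+ 2)^-1 <= 2 - 2 / n.+1%:R :> R.
  by move=> /le_trans; apply; rewrite gerBl divr_ge0.
elim: n => [|n ih]; first by rewrite big_ord0 divr1 subrr.
rewrite big_ord_recr/=; apply: (le_trans (lerD ih (lexx _))).
rewrite -[n.+2%:R]natr1; set m : R := n.+1%:R.
have m1 : 1 <= m by rewrite ler1n.
rewrite -subr_ge0.
have -> : 2 - 2 / (m + 1) - (2 - 2 / m + (m ^+ 2)^-1) = (m - 1) / (m ^+ 2 * (m + 1)).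
  by field; rewrite gt_eqF ?gt_eqF//; lra.
by rewrite divr_ge0 ?subr_ge0// mulr_ge0 ?sqr_ge0//; lra.
Qed.

End avoid.

(** * The thinned sequence and the set of alpha leaving a cell empty *)

Lemma lacunary_growth (R : realType) (r : R) (a : nat -> nat) (n k : nat) :
  lacunary r a -> (1 <= n)%N -> r ^+ k * (a n)%:R <= (a (n + k)%N)%:R.
Proof.
move=> [r1 lac] n1; elim: k => [|k ih]; first by rewrite mul1r addn0.
rewrite exprS -mulrA addnS; apply: le_trans (lac _ _); last exact: ltn_addr.
by rewrite ler_wpM2l//; lra.
Qed.

Lemma path_iota_map (T : Type) (e : rel T) (f : nat -> T) (p : T) (m M : nat) :
  e p (f m) -> (forall i, (m <= i)%N -> e (f i) (f i.+1)) ->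
  path e p [seq f i | i <- iota m M].
Proof.
elim: M m p => [//|M ih] m p pm fe /=; rewrite pm /=; apply: ih; first exact: fe.
by move=> i mi; apply: fe; exact: ltnW.
Qed.

Section missing.
Context {R : realType}.
Local Notation mu := (@lebesgue_measure R).

Definition missing_cell (a : nat -> nat) (K L M : nat) : set R :=
  (\bigcup_(j in `I_K) (`[0, 1] `&`
     avoid (j%:R / K%:R) K%:R^-1 [seq (a (i * L)%N)%:R | i <- iota 1 M]))%classic.

Lemma measurable_missing_cell a K L M : measurable (missing_cell a K L M).
Proof.
apply: bigcup_measurable => j _; apply: measurableI => //.
exact: measurable_avoid.
Qed.

Lemma missing_cell_measure (r : R) (a : nat -> nat) (K L M : nat) :
  (forall n, (1 <= n)%N -> (0 < a n)%N) -> lacunary r a ->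
  (0 < K)%N -> (0 < L)%N -> 4 * K%:R <= r ^+ L ->
  (mu (missing_cell a K L M) <= (3 * K%:R * (1 - K%:R^-1 / 2) ^+ M)%R%:E)%E.
Proof.
move=> a_pos lac K0 L0 KL.
set s : R := K%:R^-1.
have K1 : 1 <= K%:R :> R by rewrite ler1n.
have s01 : 0 < s <= 1 by rewrite invr_gt0 invf_le1 ?ltr0n// K0.
have sQ : 4 <= s * r ^+ L by rewrite mulrC ler_pdivlMr ?ltr0n.
have Q0 : 0 < r ^+ L by have [r1 _] := lac; rewrite exprn_gt0//; lra.
set bs := [seq (a (i * L)%N)%:R : R | i <- iota 1 M].
(* The fictitious first term [b0 = Q^-1] makes the first growth condition read [1 <= a L], and the
   length factor on [[0, 1]] becomes [1 + 2 = 3]. *)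
have pbs : path (fun p q => r ^+ L * p <= q) (r ^+ L)^-1 bs.
  apply: path_iota_map => [|i i1].
    by rewrite divff ?gt_eqF// mul1n ler1n a_pos.
  by rewrite mulSn addnC; apply: lacunary_growth => //; rewrite muln_gt0 i1.
have mA (j : nat) : measurable (`[0, 1] `&` avoid (j%:R / K%:R) s bs)%classic.
  by apply: measurableI => //; exact: measurable_avoid.
have sub : (missing_cell a K L M `<=` \big[setU/set0]_(j < K)
    (fun j : nat => (`[0, 1] `&` avoid (j%:R / K%:R) s bs)%classic) j)%classic.
  by rewrite -(bigcup_mkord K (fun j : nat => (`[0, 1] `&` avoid (j%:R / K%:R) s bs)%classic)).
apply: (le_trans (@content_subadditive _ _ _ mu _ _ K
  (fun j _ => mA j) (measurable_missing_cell a K L M) sub)).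
apply: (@le_trans _ _ (\sum_(j < K) ((1 - s / 2) ^+ M * 3)%R%:E)%E).
  apply: lee_sum => j _.
  have := @avoid_measure R (j%:R / K%:R) s (r ^+ L) bs (r ^+ L)^-1 0 1 s01 sQ.
  rewrite invr_gt0 add0r size_map size_iota => /(_ Q0 ler01 pbs) /le_trans; apply.
  by rewrite divff ?gt_eqF// lee_fin divr1 -natr1 addrC.
rewrite sumEFin lee_fin sumr_const card_ord -[leLHS]mulr_natl.
by rewrite le_eqVlt; apply/orP; left; apply/eqP; rewrite -/s; ring.
Qed.

(** As [M * L <= N], every sampled index [i * L] is among the first [N], so a cell hit by the sample
    is hit by the full family. *)
Lemma max_gap_le_of_not_missing (a : nat -> nat) (K L M N : nat) (x : R) :
  (0 < K)%N -> (0 < L)%N -> (M * L <= N)%N -> 0 <= x <= 1 -> ~ missing_cell a K L M x ->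
  max_gap [seq x * (a n)%:R | n <- iota 1 N] <= 2 / K%:R.
Proof.
move=> K0 L0 MLN x01 nmiss; apply: max_gap_le => // j jK.
apply: contrapT => nohit; apply: nmiss; exists j => //; split; first by rewrite /= in_itv.
apply/allP => _ /mapP[i iM ->]; rewrite leNgt; apply/negP => hit.
apply: nohit; exists (x * (a (i * L)%N)%:R) => //.
apply: map_f; move: iM; rewrite !mem_iota !add1n !ltnS => /andP[i1 iM].
by rewrite muln_gt0 i1 L0 (leq_trans _ MLN)// leq_mul2r iM orbT.
Qed.

End missing.

(** * Choice of the number of cells and of the thinning *)

Lemma ln_nat_ge (R : realType) (c : R) :
  exists2 N0 : nat, (1 <= N0)%N & forall N, (N0 <= N)%N -> c <= ln N%:R.
Proof.
exists (Num.truncn (expR c)).+1 => // N N0N.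
have : expR c <= N%:R.
  by apply: ltW; apply: (lt_le_trans (truncnS_gt _)); rewrite ler_nat.
by move=> h; rewrite -[c]expRK ler_ln ?posrE ?expR_gt0// (lt_le_trans (expR_gt0 c)).
Qed.

Lemma natr_between (R : realType) (x : R) : 0 <= x ->
  exists2 n : nat, (0 < n)%N & x < n%:R /\ n%:R <= x + 1.
Proof.
move=> x0; have /andP[lo hi] := truncn_itv x0; exists (Num.truncn x).+1 => //.
by split=> //; rewrite -natr1 lerD2r.
Qed.

(** With [u = ln N], take [K] just above [2 / T] for the gap size [T = A * u ^ 2 / N], [L] just
    above [u / ln r], and [M = N %/ L]. *)
Lemma sampling_parameters (R : realType) (r eps : R) : 1 < r -> 0 < eps ->
  exists2 N0 : nat, (1 <= N0)%N & forall N, (N0 <= N)%N ->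
  exists K L M : nat, [/\ (0 < K)%N /\ (0 < L)%N, 4 * K%:R <= r ^+ L, (M * L <= N)%N,
    2 / K%:R <= ln N%:R `^ (2 + eps) / N%:R &
    3 * K%:R * (1 - K%:R^-1 / 2) ^+ M <= 3 / N%:R ^+ 2 :> R].
Proof.
move=> r1 eps0; have lr0 : 0 < ln r by exact: ln_gt0.
pose B := 1 / ln r + 1; pose A := 36 * B.
have B1 : 1 < B by rewrite /B ltrDr divr_gt0.
have A36 : 36 < A by rewrite /A; lra.
(* The three summands give [1 <= u], then [A * u ^ 2 <= u ^ 3 / 6 <= N], and [A <= u ^ eps]. *)
have [N0 N01 hN0] := @ln_nat_ge R (1 + 6 * A + A `^ eps^-1).
exists N0 => // N N0N; have Nn0 : (0 < N)%N by exact: leq_trans N0N.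
have N0' : 0 < N%:R :> R by rewrite ltr0n.
have := hN0 _ N0N; set u := ln N%:R; have := powR_ge0 A eps^-1.
set p := A `^ eps^-1 => p0 hu.
have u1 : 1 <= u by lra.
have expu : expR u = N%:R by rewrite lnK.
have uN : A * u ^+ 2 <= N%:R.
  have := @expR_ge1Dxn R u 2; rewrite expu => /(_ ltac:(lra)) /=.
  have -> : (3`!)%:R = 6 :> R by [].
  by nra.
pose T := A * u ^+ 2 / N%:R.
have u2 : 1 <= u ^+ 2 by rewrite expr_ge1//; lra.
have Au0 : 0 < A * u ^+ 2 by nra.
have T0 : 0 < T by rewrite divr_gt0.
have T1 : T <= 1 by rewrite ler_pdivrMr// mul1r.
have T20 : 0 <= 2 / T by rewrite divr_ge0// ltW.
have [K Kn0 [Klo Khi]] := natr_between _ _ T20.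
have ulr0 : 0 <= u / ln r by rewrite divr_ge0 ?ltW//; lra.
have [L Ln0 [Llo Lhi]] := natr_between _ _ ulr0.
pose M := (N %/ L)%N.
have K0 : 0 < K%:R :> R by rewrite ltr0n.
have K3 : K%:R <= 3 / T.
  apply: (le_trans Khi); have : 1 <= T^-1 by rewrite invf_ge1.
  lra.
have KN : 4 * K%:R <= N%:R :> R.
  have : 3 / T <= N%:R / 4.
    rewrite /T invf_div mulrCA ler_pM2l// ler_pdivrMr//.
    by nra.
  lra.
exists K, L, M; split => //.
(* [r ^ L = exp (L * ln r)] is at least [exp u = N], hence at least [4 * K]. *)
- apply: (le_trans KN); rewrite -expu -[r]lnK ?posrE; last lra.
  by rewrite -expRM_natl ler_expR -ler_pdivrMr// ltW.
- exact: leq_trunc_div.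
- apply: (@le_trans _ _ T).
    by rewrite ler_pdivrMr// mulrC -ler_pdivrMr// ltW.
  rewrite ler_pM2r ?invr_gt0// powRD; last by apply/implyP => _; rewrite gt_eqF//; lra.
  rewrite powR_mulrn; last lra.
  rewrite mulrC ler_pM2l; last lra.
  (* The extra power [u ^ eps] absorbs the constant [A]. *)
  have -> : A = p `^ eps by rewrite /p -powRrM mulVf ?gt_eqF// powRr1//; lra.
  by rewrite ge0_ler_powR ?nnegrE//; lra.
have LB : L%:R <= B * u by rewrite /B; nra.
have L0 : 0 < L%:R :> R by rewrite ltr0n.
(* From [M >= N / (2 * B * u)] and [K <= 3 * N / (A * u ^ 2)] the ratio is at least
   [A * u / (12 * B)]; this is why [A = 36 * B]. *)
have MK : 3 * u <= M%:R / (2 * K%:R).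
  have h1 : N%:R <= (M%:R + 1) * (B * u).
    apply: (@le_trans _ _ ((M%:R + 1) * L%:R)); last by rewrite ler_wpM2l.
    rewrite natr1 -natrM ler_nat {1}(divn_eq N L) mulSn addnC leq_add2r.
    by rewrite ltnW// ltn_mod.
  have h2 : N%:R <= 2 * M%:R * (B * u).
    have : 2 * (B * u) <= N%:R.
      apply: le_trans uN; rewrite /A; nra.
    nra.
  have h3 : K%:R * (A * u ^+ 2) <= 3 * N%:R.
    by rewrite -ler_pdivlMr// -mulrA; move: K3; rewrite /T invf_div.
  rewrite ler_pdivlMr; last lra.
  have Bu0 : 0 < B * u by nra.
  rewrite -(ler_pM2r Bu0).
  have -> : 3 * u * (2 * K%:R) * (B * u) = K%:R * (A * u ^+ 2) / 6 by rewrite /A; field.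
  nra.
have c0 : 0 <= 1 - K%:R^-1 / 2 :> R.
  by have : K%:R^-1 <= 1 :> R; [rewrite invf_le1// ler1n|lra].
(* By [1 - t <= exp (- t)] the power is at most [exp (- 3 * u) = N ^ -3]; the factor [K <= N] of the
   union bound then leaves [N ^ -2]. *)
have hM : (1 - K%:R^-1 / 2) ^+ M <= (N%:R ^+ 3)^-1 :> R.
  apply: (@le_trans _ _ (expR (- (M%:R / (2 * K%:R))))).
    have -> : - (M%:R / (2 * K%:R)) = M%:R * - (K%:R^-1 / 2) :> R.
      by field; rewrite gt_eqF.
    rewrite expRM_natl lerXn2r ?nnegrE ?expR_ge0//.
    exact: expR_ge1Dx.
  by rewrite -expu -expRM_natl -expRN ler_expR lerN2.
apply: (@le_trans _ _ (3 * N%:R * (N%:R ^+ 3)^-1)).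
  by apply: ler_pM; rewrite ?exprn_ge0// ?mulr_ge0//; lra.
suff -> : 3 * N%:R * (N%:R ^+ 3)^-1 = 3 / N%:R ^+ 2 :> R by [].
by field; rewrite gt_eqF.
Qed.

(** * The almost sure bound, from one exceptional set for each [N] *)

Theorem theorem2p3 (R : realType) (eps r : R) (a : nat -> nat)
    (heps : 0 < eps) (hr : 1 < r)
    (a_pos : forall n : nat, (1 <= n)%N -> (0 < a n)%N)
    (a_incr : forall m n : nat, (1 <= m)%N -> (m < n)%N -> (a m < a n)%N)
    (a_lac : lacunary r a) :
  {ae (@lebesgue_measure R), forall alpha : R, 0 <= alpha <= 1 ->
    exists N0 : nat, (1 <= N0)%N /\
      forall N : nat, (N0 <= N)%N ->
        max_gap [seq alpha * (a n)%:R | n <- iota 1 N]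
          <= (ln N%:R) `^ (2 + eps) / N%:R}.
Proof.
have [N1 N11 hN1] := sampling_parameters _ _ _ hr heps.
(* Index [n] stands for [N = N1 + n], so parameters exist for every [n], and [N1 >= 1] gives
   [3 / N ^ 2 <= 3 / n.+1 ^ 2]. *)
have /choice[f hf] : forall n, exists KLM : nat * nat * nat,
    let: (K, L, M) := KLM in let N := (N1 + n)%N in
    [/\ (0 < K)%N /\ (0 < L)%N, 4 * K%:R <= r ^+ L, (M * L <= N)%N,
      2 / K%:R <= ln N%:R `^ (2 + eps) / N%:R &
      3 * K%:R * (1 - K%:R^-1 / 2) ^+ M <= 3 / N%:R ^+ 2 :> R].
  move=> n; have [K [L [M h]]] := hN1 _ (leq_addr n N1).
  by exists (K, L, M).
pose F n : set R := let: (K, L, M) := f n in missing_cell a K L M.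
have mF n : measurable (F n).
  by rewrite /F; case: (f n) => [[K L] M]; exact: measurable_missing_cell.
exists (lim_sup_set F); split.
- apply: bigcap_measurable; first by exists 0%N.
  by move=> n _; apply: bigcup_measurable => j _; exact: mF.
- apply: (@borel_cantelli_inv_sqr R F 3) => // n.
  have := hf n; rewrite /F; case: (f n) => [[K L] M] [[K0 L0] KL _ _ h].
  apply: (le_trans (missing_cell_measure _ _ _ _ M a_pos a_lac K0 L0 KL)); rewrite lee_fin.
  apply: (le_trans h); rewrite ler_pM2l// lef_pV2 ?posrE ?exprn_gt0 ?ltr0n ?addn_gt0 ?N11//.
  by rewrite lerXn2r ?nnegrE ?ler0n// ler_nat -add1n leq_add2r.
move=> x /= nP; apply: contrapT => nlim; apply: nP => x01.
(* Outside the limit superior, [x] lies in only finitely many of the exceptional sets. *)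
have [n hn] : exists n, forall j, (n <= j)%N -> ~ F j x.
  apply: contrapT => h; apply: nlim => n _; apply: contrapT => hn.
  by apply: h; exists n => j nj Fj; apply: hn; exists j.
exists (N1 + n)%N; split; first by rewrite addn_gt0 N11.
move=> N hN; have N1N : (N1 <= N)%N by rewrite (leq_trans _ hN)// leq_addr.
have := hn (N - N1)%N; have := hf (N - N1)%N; rewrite /F subnKC//.
case: (f _) => [[K L] M] [[K0 L0] _ MLN h _] nb.
apply: le_trans h; apply: (max_gap_le_of_not_missing _ _ _ _ _ _ K0 L0 MLN x01); apply: nb.
by rewrite leq_subRL.
Qed.
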